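(* Let $0<\psi_M<\pi$ and $0<C_*\le C^*$. There exists $\psi_m>0$, depending only on $\psi_M$, $C_*$ and $C^*$, such that every convex quadrilateral $K\subset\mathbb{R}^2$ satisfying $MAC(\psi_M)$ and $clos(C_*,C^* )$ also satisfies $mac(\psi_m)$. In particular, the conditions [$MAC$ and $clos$] and [$DAC$ and $clos$] are equivalent.
   Context: A convex quadrilateral $K$ satisfies the maximum angle condition $MAC(\psi_M)$ if all its inner angles $\theta$ satisfy $\theta\le\psi_M<\pi$; it satisfies the minimum angle condition $mac(\psi_m)$ if all its inner angles satisfy $0<\psi_m\le\theta$; it satisfies the double angle condition $DAC(\psi_m,\psi_M)$ if it satisfies both $MAC(\psi_M)$ and $mac(\psi_m)$. It satisfies the property of comparable lengths for opposite sides $clos(C_*,C^* )$ if for any two opposite sides $s_1,s_2$ of $K$ one has $C_*\le |s_1|/|s_2|\le C^*$. *)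

(* Defs.v *)
From HB Require Import structures.
From mathcomp Require Import all_boot all_order all_algebra.
From mathcomp Require Import all_classical all_reals all_analysis.

Set Implicit Arguments.
Unset Strict Implicit.
Unset Printing Implicit Defensive.

Import Order.TTheory GRing.Theory Num.Theory.
Local Open Scope ring_scope.

Definition dotv (R : realType) (u v : 'rV[R]_2) : R := \sum_k u 0 k * v 0 k.

(* The Euclidean norm; the library norm `|u| on row vectors is the sup norm. *)
Definition enorm (R : realType) (u : 'rV[R]_2) : R := Num.sqrt (dotv u u).

Definition cross (R : realType) (u v : 'rV[R]_2) : R :=
  u 0 0 * v 0 1 - u 0 1 * v 0 0.

(* A quadrilateral is given by its vertices V 0, V 1, V 2, V 3 listed in
   cyclic order along the boundary.  Arithmetic on indices in 'I_4 is modulo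
   4, so that V (i + 1) and V (i - 1) are the two neighbours of V i. *)
Definition quad (R : realType) := 'I_4 -> 'rV[R]_2.

(* For every side, the two remaining vertices lie strictly on the same side of
   the line carrying it.  This forces the closed polygon V 0 V 1 V 2 V 3 to be
   simple, nondegenerate and convex.  Flat vertices (inner angle pi) are ruled
   out, as they are by the maximum angle condition. *)
Definition convex_quad (R : realType) (V : quad R) : Prop :=
  forall i : 'I_4,
    0 < cross (V (i + 1) - V i) (V (i + 2) - V i)
        * cross (V (i + 1) - V i) (V (i + 3) - V i).

Definition side_length (R : realType) (V : quad R) (i : 'I_4) : R :=
  enorm (V (i + 1) - V i).

(* The angle in [0, pi] between the two sides meeting at V i, which for a
   convex quadrilateral is the inner angle at V i. *)
Definition inner_angle (R : realType) (V : quad R) (i : 'I_4) : R :=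
  let u := V (i - 1) - V i in
  let v := V (i + 1) - V i in
  acos (dotv u v / (enorm u * enorm v)).

Definition MAC (R : realType) (psiM : R) (V : quad R) : Prop :=
  psiM < pi /\ forall i : 'I_4, inner_angle V i <= psiM.

Definition mac (R : realType) (psim : R) (V : quad R) : Prop :=
  0 < psim /\ forall i : 'I_4, psim <= inner_angle V i.

Definition DAC (R : realType) (psim psiM : R) (V : quad R) : Prop :=
  MAC psiM V /\ mac psim V.

(* The side opposite to side i is side i + 2; letting i range over all four
   indices covers both orderings of each pair of opposite sides. *)
Definition clos (R : realType) (Cl Cu : R) (V : quad R) : Prop :=
  forall i : 'I_4, Cl <= side_length V i / side_length V (i + 2) <= Cu.

(* Main.v *)
Require Import Defs.
From HB Require Import structures.
From mathcomp Require Import all_boot all_order all_algebra.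
From mathcomp Require Import all_classical all_reals all_analysis.
From mathcomp Require Import ring lra.

Set Implicit Arguments.
Unset Strict Implicit.
Unset Printing Implicit Defensive.

Import Order.TTheory GRing.Theory Num.Theory.
Import numFieldNormedType.Exports.
Local Open Scope ring_scope.

(* The four exterior angles sum to 2 pi.  Let A be a vertex of inner angle
   alpha < pi - psiM, and let a = AB, b = BC, c = CD, d = DA.  Since the other
   inner angles are at most psiM, the directions of b and c make with a angles
   in [pi - psiM, psiM] and [0, pi].  Hence the height of D over the line AB,
   |d| sin alpha, is at least |b| sin psiM, and |d| <= Cu |b| bounds alpha from
   below.  This gives psim = min (pi - psiM) (sin psiM / Cu). *)

(** * Trigonometric inequalities *)

Lemma sin_piB (R : realType) (x : R) : sin (pi - x) = sin x.
Proof. by rewrite sinB sinpi cospi mul0r mulN1r sub0r opprK. Qed.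

Lemma le_sin_id (R : realType) (x : R) : 0 <= x -> sin x <= x.
Proof.
move=> x0.
have dsin y : y \in `]0, x[ -> is_derive y 1 (@sin R) (cos y).
  by move=> _; exact: is_derive_sin.
have csin : {within `[0, x], continuous (@sin R)}%classic.
  by apply: continuous_subspaceT; exact: continuous_sin.
have [y _] := MVT_segment x0 dsin csin; rewrite sin0 !subr0 => ->.
by rewrite ler_piMl ?cos_le1.
Qed.

(** Sine increases on [0, pi / 2]; beyond pi / 2, replace [y] by its mirror image [pi - y], which is
    still at least [x]. *)
Lemma sin_le_itv (R : realType) (x y : R) :
  0 <= x <= pi / 2 -> x <= y <= pi - x -> sin x <= sin y.
Proof.
move=> hx hy; have p0 : 0 < pi :> R := pi_gt0 R.
have mono z : x <= z -> z <= pi / 2 -> sin x <= sin z.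
  move=> xz z2; rewrite leNgt ltr_sin ?in_itv /= -?leNgt //; lra.
have [y2|y2] := leP y (pi / 2); first by apply: mono => //; lra.
by rewrite -(sin_piB y); apply: mono; lra.
Qed.

(** Since cos x = 1 - 2 sin^2 (x / 2), the half angle is a zero of sine in (0, 2 pi), hence equals
    pi. *)
Lemma cos_eq1_itv (R : realType) (x : R) :
  0 < x < 4 * pi -> cos x = 1 -> x = 2 * pi.
Proof.
move=> hx; pose y := x / 2; have hy : 0 < y < 2 * pi by rewrite /y; lra.
have -> : x = y *+ 2 by rewrite -[_ *+ 2]mulr_natr divfK.
rewrite cos_mulr2n cos2sin2 => sin2.
have {sin2} : sin y ^+ 2 == 0 by apply/eqP; move: sin2; rewrite mulr2n; lra.
rewrite sqrf_eq0 => /eqP siny; rewrite mulr_natl; congr (_ *+ 2).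
have [yp|yp|//] := ltgtP y pi.
  have : 0 < sin y by apply: sin_gt0_pi; rewrite yp andbT; case/andP: hy.
  by rewrite siny ltxx.
have : 0 < sin (y - pi) by apply: sin_gt0_pi; lra.
by rewrite sinB sinpi cospi siny; lra.
Qed.

(** * Dot and cross products, angles and rotations in the plane *)

Section PlaneVectors.
Variable R : realType.
Implicit Types u v w : 'rV[R]_2.

Lemma dotvE u v : dotv u v = u 0 0 * v 0 0 + u 0 1 * v 0 1.
Proof.
rewrite /dotv big_ord_recl big_ord1; congr (_ + u _ _ * v _ _); exact: val_inj.
Qed.

Lemma dotvv_ge0 u : 0 <= dotv u u.
Proof. by rewrite dotvE addr_ge0 // -expr2 sqr_ge0. Qed.

Lemma enorm_ge0 u : 0 <= enorm u.
Proof. exact: sqrtr_ge0. Qed.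

Lemma sqr_enorm u : enorm u ^+ 2 = dotv u u.
Proof. by rewrite sqr_sqrtr // dotvv_ge0. Qed.

Lemma enormN u : enorm (- u) = enorm u.
Proof. by rewrite /enorm !dotvE !mxE !mulrNN. Qed.

Lemma dotvNl u v : dotv (- u) v = - dotv u v.
Proof. by rewrite !dotvE !mxE; ring. Qed.

Lemma crossDr u v w : cross u (v + w) = cross u v + cross u w.
Proof. by rewrite /cross !mxE; ring. Qed.

Lemma crossNr u v : cross u (- v) = - cross u v.
Proof. by rewrite /cross !mxE; ring. Qed.

Lemma crossC u v : cross u v = - cross v u.
Proof. by rewrite /cross; ring. Qed.

Lemma crossvv u : cross u u = 0.
Proof. by rewrite /cross; ring. Qed.

(** Lagrange's identity in dimension two. *)
Lemma sqr_dotv_cross u v :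
  dotv u v ^+ 2 + cross u v ^+ 2 = (enorm u * enorm v) ^+ 2.
Proof. by rewrite exprMn !sqr_enorm !dotvE /cross; ring. Qed.

Lemma enorm_gt0_cross u v : cross u v != 0 -> 0 < enorm u /\ 0 < enorm v.
Proof.
move=> uv0; have : (enorm u * enorm v) ^+ 2 != 0.
  rewrite -sqr_dotv_cross gt_eqF // ltr_wpDl ?sqr_ge0 //.
  by rewrite lt_neqAle sqr_ge0 eq_sym sqrf_eq0 uv0.
rewrite sqrf_eq0 mulf_eq0 negb_or => /andP[u0 v0].
by rewrite !lt_neqAle !enorm_ge0 ![0 == _]eq_sym u0 v0.
Qed.

(** Between consecutive edge vectors this is the exterior angle of the polygon. *)
Definition angle u v : R := acos (dotv u v / (enorm u * enorm v)).

(** Strict Cauchy-Schwarz, from Lagrange's identity. *)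
Lemma cos_angle_itv u v : cross u v != 0 ->
  -1 < dotv u v / (enorm u * enorm v) < 1.
Proof.
move=> uv0; have [u0 v0] := enorm_gt0_cross uv0.
have n0 : 0 < enorm u * enorm v by rewrite mulr_gt0.
rewrite -ltr_norml normrM normfV (gtr0_norm n0) ltr_pdivrMr // mul1r.
rewrite -ltr_sqr ?nnegrE ?(ltW n0) // real_normK ?num_real //.
rewrite -sqr_dotv_cross ltrDl lt_neqAle sqr_ge0 andbT.
by rewrite eq_sym sqrf_eq0.
Qed.

(* [t] is an angle of rotation from [u] to [v]; the sign [s] selects the
   orientation of the plane. *)
Definition polar (s : R) u v t :=
  dotv u v = enorm u * enorm v * cos t /\
  s * cross u v = enorm u * enorm v * sin t.

(** After multiplication by |v|^2, the products of [u] and [w] expand in those of [u, v] and [v, w],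
    following the addition formulas for cos and sin. *)
Lemma polar_trans s u v w t t' : s ^+ 2 = 1 -> 0 < enorm v ->
  polar s u v t -> polar s v w t' -> polar s u w (t + t').
Proof.
move=> s1 v0 [duv cuv] [dvw cvw].
have vv0 : enorm v ^+ 2 != 0 by rewrite expf_neq0 ?gt_eqF.
split; apply: (mulfI vv0).
  have -> : enorm v ^+ 2 * dotv u w =
      dotv u v * dotv v w - s ^+ 2 * cross u v * cross v w.
    by rewrite s1 sqr_enorm !dotvE /cross; ring.
  rewrite duv dvw cosD.
  have -> : s ^+ 2 * cross u v * cross v w =
      (s * cross u v) * (s * cross v w) by ring.
  by rewrite cuv cvw; ring.
have -> : enorm v ^+ 2 * (s * cross u w) =
    s * cross u v * dotv v w + dotv u v * (s * cross v w).
  by rewrite sqr_enorm !dotvE /cross; ring.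
by rewrite duv dvw cuv cvw sinD; ring.
Qed.

Lemma polar_angle s u v : s ^+ 2 = 1 -> 0 < s * cross u v ->
  polar s u v (angle u v) /\ 0 < angle u v < pi.
Proof.
move=> s1 suv; have uv0 : cross u v != 0.
  by apply: contraTneq suv => ->; rewrite mulr0 ltxx.
have [u0 v0] := enorm_gt0_cross uv0.
have n0 : 0 < enorm u * enorm v by rewrite mulr_gt0.
have /andP[xl xr] := cos_angle_itv uv0.
rewrite /polar /angle acos_gt0 ?acos_ltpi ?xl ?xr ?ltW //.
set x := _ / _; have dE : dotv u v = enorm u * enorm v * x.
  by rewrite /x mulrC divfK ?lt0r_neq0.
do !split => //; first by rewrite acosK // in_itv /= !ltW.
rewrite sin_acos ?ltW //.
(* Both sides are nonnegative, so it suffices to compare squares; Lagrange's identity then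
   applies. *)
apply/eqP; rewrite -(@eqrXn2 _ 2) ?(ltW suv) //; last first.
  by rewrite mulr_ge0 ?sqrtr_ge0 ?ltW.
have x1 : 0 <= 1 - x ^+ 2.
  by rewrite subr_ge0 -real_normK ?num_real // expr_le1 // ler_norml !ltW.
rewrite exprMn s1 mul1r exprMn sqr_sqrtr //; apply/eqP.
have -> : cross u v ^+ 2 = (enorm u * enorm v) ^+ 2 - dotv u v ^+ 2.
  by rewrite -sqr_dotv_cross; ring.
by rewrite dE; ring.
Qed.

(* Composing the rotations a -> b -> c -> d -> a shows that the sum is a
   multiple of 2 pi; as each angle lies in (0, pi), it is 2 pi. *)
Lemma sum_angles s a b c d : s ^+ 2 = 1 ->
  0 < s * cross a b -> 0 < s * cross b c ->
  0 < s * cross c d -> 0 < s * cross d a ->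
  angle a b + angle b c + angle c d + angle d a = 2 * pi.
Proof.
move=> s1 ab bc cd da.
have [Pab Hab] := polar_angle s1 ab.
have [Pbc Hbc] := polar_angle s1 bc.
have [Pcd Hcd] := polar_angle s1 cd.
have [Pda Hda] := polar_angle s1 da.
have [a0 b0] : 0 < enorm a /\ 0 < enorm b.
  by apply: enorm_gt0_cross; apply: contraTneq ab => ->; rewrite mulr0 ltxx.
have [c0 d0] : 0 < enorm c /\ 0 < enorm d.
  by apply: enorm_gt0_cross; apply: contraTneq cd => ->; rewrite mulr0 ltxx.
have [+ _] := polar_trans s1 d0
  (polar_trans s1 c0 (polar_trans s1 b0 Pab Pbc) Pcd) Pda.
rewrite -sqr_enorm -expr2 -{1}[_ ^+ 2]mulr1.
move=> /mulfI; rewrite expf_neq0 ?gt_eqF // => /(_ isT) /esym.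
by apply: cos_eq1_itv; lra.
Qed.

(** The sign [s] treats both orientations at once; [pi - angle d a] is the inner angle at A, where
    [d] ends and [a] starts. *)
Lemma angle_lower_bound s a b c d psi K :
  s ^+ 2 = 1 -> a + b + c + d = 0 ->
  0 < s * cross a b -> 0 < s * cross b c ->
  0 < s * cross c d -> 0 < s * cross d a ->
  0 < psi < pi -> pi - angle a b <= psi -> pi - angle b c <= psi ->
  pi - angle c d <= psi -> 0 < K -> enorm d <= K * enorm b ->
  Num.min (pi - psi) (sin psi / K) <= pi - angle d a.
Proof.
move=> s1 abcd ab bc cd da hpsi hB hC hD K0 dKb.
have sum := sum_angles s1 ab bc cd da.
have [Pab Hab] := polar_angle s1 ab.
have [Pbc Hbc] := polar_angle s1 bc.
have [_ cdE] := polar_angle s1 cd.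
have [[_ daE] Hda] := polar_angle s1 da.
have [a0 b0] : 0 < enorm a /\ 0 < enorm b.
  by apply: enorm_gt0_cross; apply: contraTneq ab => ->; rewrite mulr0 ltxx.
have c0 := enorm_ge0 c.
have [_ abE] := Pab.
have [_ acE] := polar_trans s1 b0 Pab Pbc.
move: sum hB hC hD Hab Hbc cdE Hda abE acE daE; rewrite ge_min.
set t1 := angle a b; set t2 := angle b c; set t3 := angle c d.
set t4 := angle d a; move=> sum hB hC hD Hab Hbc Hcd Hda abE acE daE.
have [//|small] := leP (pi - psi) (pi - t4); rewrite /=.
(* The height of D over the line AB, reached through B and C or directly from A: cross [a] with the
   closing relation and cancel |a|. *)
have height : enorm b * sin t1 + enorm c * sin (t1 + t2) = enorm d * sin t4.
  apply: (mulfI (lt0r_neq0 a0)); rewrite mulrDr !mulrA -abE -acE.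
  rewrite [enorm a * enorm d]mulrC -daE.
  have -> : d = - (a + b + c) by apply/eqP; rewrite -addr_eq0 addrC abcd.
  by rewrite /cross !mxE; ring.
(* Here [t3 >= pi - psi] and [t4 > psi], so the total 2 pi leaves [t1 + t2 < pi]. *)
have sin12 : 0 <= sin (t1 + t2) by apply: sin_ge0_pi; lra.
(* Likewise [t2, t3 >= pi - psi] and [t4 > psi] give [t1 < psi], so [t1] lies in [pi - psi, psi], an
   interval symmetric about pi / 2. *)
have sin1 : sin psi <= sin t1.
  by rewrite -(sin_piB psi); apply: sin_le_itv; lra.
have sin4 : sin t4 <= pi - t4 by rewrite -(sin_piB t4); apply: le_sin_id; lra.
have t4_ge0 : 0 <= pi - t4 by lra.
rewrite ler_pdivrMr // -(ler_pM2l b0).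
have h1 : enorm b * sin psi <= enorm b * sin t1 by rewrite ler_pM2l.
have h2 : 0 <= enorm c * sin (t1 + t2) by rewrite mulr_ge0.
have h3 : enorm d * sin t4 <= enorm d * (pi - t4).
  by rewrite ler_wpM2l ?enorm_ge0.
have h4 : enorm d * (pi - t4) <= K * enorm b * (pi - t4) by rewrite ler_wpM2r.
have -> : enorm b * ((pi - t4) * K) = K * enorm b * (pi - t4) by ring.
lra.
Qed.

End PlaneVectors.

(** * From edge vectors to quadrilaterals *)

Section Quadrilaterals.
Variable R : realType.
Implicit Types V : quad R.

Definition edge V i := V (i + 1) - V i.

Lemma ord4D3 (i : 'I_4) : i + 3 = i - 1.
Proof. by apply: val_inj; case: i => [[|[|[|[|]]]]]. Qed.

(** Reversing the incoming edge negates the cosine, and acos (- x) = pi - acos x. *)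
Lemma inner_angleE V i : cross (edge V (i - 1)) (edge V i) != 0 ->
  inner_angle V i = pi - angle (edge V (i - 1)) (edge V i).
Proof.
move=> nz; have /andP[xl xr] := cos_angle_itv nz.
rewrite /inner_angle /angle -acosN ?ltW //; congr acos.
rewrite -/(edge V i); have -> : V (i - 1) - V i = - edge V (i - 1).
  by rewrite /edge subrK opprB.
by rewrite enormN dotvNl mulNr.
Qed.

(* The two determinants in [convex_quad] are the orientations of the corners
   at [V (i + 1)] and at [V i], so all corners have the same orientation. *)
Lemma convex_quad_cross V i : convex_quad V ->
  0 < cross (edge V i) (edge V (i + 1)) * cross (edge V (i - 1)) (edge V i).
Proof.
move=> /(_ i); congr (0 < _ * _).
  have -> : V (i + 2) - V i = edge V i + edge V (i + 1).
    by rewrite /edge -[i + 1 + 1]addrA [RHS]addrC [RHS]addrA subrK.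
  by rewrite crossDr crossvv add0r.
rewrite ord4D3.
have -> : V (i - 1) - V i = - edge V (i - 1) by rewrite /edge subrK opprB.
by rewrite crossNr -crossC.
Qed.

Lemma mac_of_MAC_clos V psi Cl Cu : 0 < psi < pi -> 0 < Cu ->
  convex_quad V -> MAC psi V -> clos Cl Cu V ->
  mac (Num.min (pi - psi) (sin psi / Cu)) V.
Proof.
move=> hpsi Cu0 cV [_ hM] hclos; split.
  by rewrite lt_min subr_gt0 divr_gt0 ?sin_gt0_pi // andbT; case/andP: hpsi.
move=> i.
(* The vertex [V i] takes the role of A. *)
pose a := edge V i; pose b := edge V (i + 1); pose c := edge V (i + 2).
pose d := edge V (i + 3).
have Eb : i + 1 + 1 = i + 2 by rewrite -addrA.
have Ec : i + 2 + 1 = i + 3 by rewrite -addrA; congr +%R; exact: val_inj.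
have Ed : i + 3 + 1 = i by rewrite ord4D3 subrK.
have abcd : a + b + c + d = 0.
  by rewrite /a /b /c /d /edge Eb Ec Ed; apply/rowP => k; rewrite !mxE; ring.
have hA := convex_quad_cross i cV.
have hB := convex_quad_cross (i + 1) cV.
have hC := convex_quad_cross (i + 2) cV.
have E1 : i + 1 - 1 = i by rewrite addrK.
have E2 : i + 2 - 1 = i + 1 by rewrite -Eb addrK.
have E3 : i + 3 - 1 = i + 2 by rewrite -Ec addrK.
move: hA hB hC; rewrite Eb Ec E1 E2 -ord4D3.
rewrite -/a -/b -/c -/d => hA hB hC.
(* The common orientation: products of neighbouring corner determinants are positive, so all four
   share this sign. *)
pose s := Num.sg (cross a b).
have ab0 : cross a b != 0 by apply: contraTneq hA => ->; rewrite mul0r ltxx.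
have s1 : s ^+ 2 = 1 by rewrite /s sqr_sg ab0.
have sg_eq (x y : R) : 0 < x * y -> Num.sg x = Num.sg y.
  by case: (sgrP x); case: (sgrP y) => // *; nra.
have sg_gt0 (x : R) : x != 0 -> 0 < Num.sg x * x.
  by rewrite -normrEsg normr_gt0.
have neq0 (x y : R) : 0 < x * y -> (x != 0) && (y != 0).
  by move=> xy; rewrite -negb_or -mulf_eq0 gt_eqF.
have /andP[_ da0] := neq0 _ _ hA; have /andP[bc0 _] := neq0 _ _ hB.
have /andP[cd0 _] := neq0 _ _ hC.
have ab : 0 < s * cross a b by exact: sg_gt0.
have da : 0 < s * cross d a by rewrite /s (sg_eq _ _ hA) sg_gt0.
have bc : 0 < s * cross b c by rewrite /s -(sg_eq _ _ hB) sg_gt0.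
have cd : 0 < s * cross c d.
  by rewrite /s -(sg_eq _ _ hB) -(sg_eq _ _ hC) sg_gt0.
rewrite inner_angleE -ord4D3 //.
apply: (angle_lower_bound s1 abcd ab bc cd da hpsi) => //.
- by have := hM (i + 1); rewrite inner_angleE E1.
- by have := hM (i + 2); rewrite inner_angleE E2.
- by have := hM (i + 3); rewrite inner_angleE E3.
have [_ b0] := enorm_gt0_cross ab0.
(* The side opposite [d] is [b], so [clos] at index [i + 3] bounds |d| / |b| by [Cu]. *)
have := hclos (i + 3); rewrite /side_length.
have -> : i + 3 + 2 = i + 1 by rewrite -addrA; congr +%R; exact: val_inj.
by rewrite -/(edge V (i + 3)) -/(edge V (i + 1)) ler_pdivrMr // => /andP[].
Qed.

End Quadrilaterals.

Theorem lemma2p5 (R : realType) (psiM Cl Cu : R)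
    (hpsiM0 : 0 < psiM) (hpsiMpi : psiM < pi)
    (hCl : 0 < Cl) (hClCu : Cl <= Cu) :
  exists psim : R,
    [/\ 0 < psim,
        (forall V : quad R,
           convex_quad V -> MAC psiM V -> clos Cl Cu V -> mac psim V)
      & (forall V : quad R, convex_quad V ->
           ((MAC psiM V /\ clos Cl Cu V) <->
            (DAC psim psiM V /\ clos Cl Cu V)))].
Proof.
have Cu0 : 0 < Cu := lt_le_trans hCl hClCu.
have hpsi : 0 < psiM < pi by rewrite hpsiM0.
exists (Num.min (pi - psiM) (sin psiM / Cu)); split.
- by rewrite lt_min subr_gt0 hpsiMpi divr_gt0 ?sin_gt0_pi.
- by move=> V cV hM hc; exact: mac_of_MAC_clos hpsi Cu0 cV hM hc.
- move=> V cV; split=> [[hM hc]|[[hM _] hc]]; last by split.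
  by split=> //; split=> //; exact: mac_of_MAC_clos hpsi Cu0 cV hM hc.
Qed.
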